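(* Let $G$ be a bi-rigid left $\ell$-group such that $\mathrm{At}(G)$ is finite. Then, up to equivalence, there are only finitely many $\mathrm{I}_G$-formations.
   Context: A left-ordered group is a group $G$ with a partial order $\leq$ such that $y\leq z$ implies $xy\leq xz$ for all $x,y,z\in G$; it is a left $\ell$-group if $(G,\leq)$ is a lattice (binary joins $\vee$ and meets $\wedge$ exist). Let $e$ be the identity, $G^+=\{g\in G: g\geq e\}$, $G^-=\{g\in G: g\leq e\}$. $G$ is noetherian if every ascending chain $x_1\leq x_2\leq\dots$ in $G^-$ becomes stationary and every descending chain $y_1\geq y_2\geq\dots$ in $G^+$ becomes stationary. Write $x\prec y$ if $x<y$ and there is no $z$ with $x<z<y$. $\mathrm{At}(G)=\{x\in G: e\prec x\}$ is the set of atoms. A left $\ell$-group $G$ is rigid if it is noetherian and: (1) for any $x,y\in\mathrm{At}(G)$ with $x\neq y$ there is a unique $z\in\mathrm{At}(G)$ with $xz\leq x\vee y$; (2) for any $x\in\mathrm{At}(G)$ there is at most one $z\in\mathrm{At}(G)$ such that $xz\not\leq x\vee y$ for all $y\in\mathrm{At}(G)$. $G^{\mathrm{op}}$ denotes the group $G$ with the reversed order (again a left $\ell$-group). $G$ is dually rigid if $G^{\mathrm{op}}$ is rigid, and bi-rigid if it is both rigid and dually rigid. For a left-ordered group $G$, an $\mathrm{I}_G$-formation is a pair $(H,\iota)$ where $H$ is a left-ordered group and $\iota:(H,\leq)\to(G,\leq)$ is an order-isomorphism (not necessarily a group homomorphism) with $\iota(e_H)=e_G$. Two $\mathrm{I}_G$-formations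 $(H,\iota)$, $(H',\iota')$ are equivalent if there is an isomorphism of left-ordered groups (group isomorphism that is also an order-isomorphism) $f:H\to H'$ with $\iota'\circ f=\iota$. *)

(* Defs.v *)
From HB Require Import structures.
From mathcomp Require Import all_boot all_order.
From mathcomp Require Import boolp classical_sets functions cardinality.

Set Implicit Arguments.
Unset Strict Implicit.
Unset Printing Implicit Defensive.

Import Order.Theory.

Local Open Scope group_scope.
Local Open Scope order_scope.

HB.mixin Record isLeftOrdered (d : Order.disp_t) G
    of Group G & Order.POrder d G := {
  le_mul2l : forall x y z : G, y <= z -> x * y <= x * z
}.

#[short(type="leftOrderedGroupType")]
HB.structure Definition LeftOrderedGroup (d : Order.disp_t) :=
  {G of Group G & Order.POrder d G & isLeftOrdered d G}.

#[short(type="leftLGroupType")]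
HB.structure Definition LeftLGroup (d : Order.disp_t) :=
  {G of LeftOrderedGroup d G & Order.Lattice d G}.

(* The group G^op is the library's order dual G^d, which is convertible to G
   as a type, equipped with the multiplication of G. *)
HB.instance Definition _ (G : groupType) := Group.copy G^d G.

Fact dual_le_mul2l (d : Order.disp_t) (G : leftOrderedGroupType d)
  (x y z : G^d) : y <= z -> (x * y : G^d) <= (x * z : G^d).
Proof. exact: (@le_mul2l d G x z y). Qed.

HB.instance Definition _ (d : Order.disp_t) (G : leftOrderedGroupType d) :=
  isLeftOrdered.Build (Order.dual_display d) G^d (@dual_le_mul2l d G).

HB.saturate Order.dual.

Definition covers (d : Order.disp_t) (G : leftOrderedGroupType d)
    (x y : G) : Prop :=
  x < y /\ ~ exists z : G, x < z < y.

Definition atoms (d : Order.disp_t) (G : leftOrderedGroupType d) : set G :=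
  [set x | covers 1 x]%classic.
Arguments atoms {d} G _.

Definition noetherian (d : Order.disp_t) (G : leftOrderedGroupType d) : Prop :=
  (forall x : nat -> G, (forall n, x n <= 1) -> (forall n, x n <= x n.+1) ->
     exists N, forall n, (N <= n)%N -> x n = x N) /\
  (forall y : nat -> G, (forall n, 1 <= y n) -> (forall n, y n.+1 <= y n) ->
     exists N, forall n, (N <= n)%N -> y n = y N).

Definition rigid (d : Order.disp_t) (G : leftLGroupType d) : Prop :=
  [/\ noetherian G,
      forall x y : G, atoms G x -> atoms G y -> x <> y ->
        exists! z : G, atoms G z /\ x * z <= x `|` y
    & forall x : G, atoms G x -> forall z z' : G,
        atoms G z -> (forall y : G, atoms G y -> ~ (x * z <= x `|` y)) ->
        atoms G z' -> (forall y : G, atoms G y -> ~ (x * z' <= x `|` y)) ->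
        z = z'].

Definition dually_rigid (d : Order.disp_t) (G : leftLGroupType d) : Prop :=
  rigid G^d.

Definition bi_rigid (d : Order.disp_t) (G : leftLGroupType d) : Prop :=
  rigid G /\ dually_rigid G.

Definition order_iso (d d' : Order.disp_t) (P : porderType d)
    (Q : porderType d') (f : P -> Q) : Prop :=
  bijective f /\ {mono f : x y / x <= y}.

(* The display of the group of a formation is a mere notational tag, so it is
   left unconstrained. *)
Record formation (d : Order.disp_t) (G : leftOrderedGroupType d) := Formation {
  form_disp : Order.disp_t;
  form_group : leftOrderedGroupType form_disp;
  form_map : form_group -> G;
  form_iso : order_iso form_map;
  form_map1 : form_map 1 = 1
}.
Arguments form_map {d G} F _ : rename.

Definition formation_equiv (d : Order.disp_t) (G : leftOrderedGroupType d)
    (F F' : formation G) : Prop :=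
  exists f : form_group F -> form_group F',
    [/\ order_iso f, {morph f : x y / x * y}
      & form_map F' \o f =1 form_map F].

(* Main.v *)
Require Import Defs.
From mathcomp Require Import all_boot all_order.
From mathcomp Require Import boolp classical_sets functions cardinality.

(** Transporting the multiplication of a formation along its order isomorphism
turns it into a second group law on the poset [G], still with unit [1] and
still with order-preserving left translations.  Two formations are equivalent
exactly when these transported laws agree, so the task is to show that the
poset [G] carries only finitely many such laws.

The core is a rigidity theorem, [poset_automorphism_rigidity]: an automorphism
of the poset [G] that fixes [1], the atoms and the coatoms is the identity.
- Going up ([fixes_atoms_step], [fixes_atoms_pos]).  Suppose that [phi] fixes
  [1] and the atoms.  Then it fixes the joins [x `|` y] of atoms, and by
  rigidity an upper cover [x * z] of an atom [x] is recognised among all upper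
  covers of [x] by the joins [x `|` y] that lie above it.  So [phi] fixes the
  upper covers of [x], and after translating [x] back to [1] the situation is
  the same as before.  As every positive element is a product of atoms, [phi]
  fixes everything above [1]; by duality, a map that fixes [1] and the coatoms
  fixes everything below [1].
- Going down ([join_determines_atom], [fixes_atoms_below]).  Suppose that [phi]
  fixes [g * x] and everything above it, for some atom [x], and that it fixes
  [g].  It then permutes the upper covers [g * y] of [g] without changing
  [g * (x `|` y)].  By a counting argument, which is where the finiteness of
  the set of atoms enters, distinct [y] give distinct joins [x `|` y]; so [phi]
  fixes all upper covers of [g], hence everything above [g].  Descending from
  [1], everything above a negative element is fixed, and in a lattice every
  element lies above a negative one.

Rigidity bounds the number of laws.  A translation of a transported law is a
poset automorphism, and two translations by the same [x] differ by an
automorphism fixing [1].  The translation by [x] is therefore determined by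
its values at the finitely many atoms and coatoms [y], and these values are
all of the form [x] times an atom or a coatom.  Finally, a formation is
generated as a monoid by its atoms and coatoms, so its law is determined by
the translations by those [x].  This leaves finitely many possibilities, of
which [code] in the last proof keeps the record. *)

Set Implicit Arguments.
Unset Strict Implicit.
Unset Printing Implicit Defensive.

Import Order.Theory.

Local Open Scope group_scope.
Local Open Scope order_scope.

(** * Chain conditions and induction along atoms *)

Lemma wf_no_descent (T : Type) (R : T -> T -> Prop) :
  (forall u : nat -> T, ~ forall n, R (u n.+1) (u n)) -> well_founded R.
Proof.
move=> noR x0; apply: contrapT => nAcc0.
have /choice[next nextP] :
    forall x, exists y, ~ Acc R x -> R y x /\ ~ Acc R y.
  move=> x.
  have [accx|nAccx] := pselect (Acc R x); first by exists x.
  apply: contrapT => none; apply: nAccx; constructor=> y Ryx.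
  by apply: contrapT => nAccy; apply: none; exists y.
have iterP n : ~ Acc R (iter n next x0) by elim: n => //= n /nextP[].
by apply: (noR (fun n => iter n next x0)) => n; case: (nextP _ (iterP n)).
Qed.

Section LeftOrdered.
Variables (d : Order.disp_t) (G : leftOrderedGroupType d).
Implicit Types x y z g h : G.

Lemma le_mul2lE g : {mono (fun x => g * x) : x y / x <= y}.
Proof.
move=> x y; apply/idP/idP; last exact: le_mul2l.
by move=> /(le_mul2l g^-1); rewrite !mulKg.
Qed.

Lemma lt_mul2lE g : {mono (fun x => g * x) : x y / x < y}.
Proof. exact: leW_mono (le_mul2lE g). Qed.

Lemma order_iso_mul g : order_iso (fun x => g * x).
Proof.
by split; [exists (fun x => g^-1 * x) => x; rewrite ?mulKg ?mulVKg
          | exact: le_mul2lE].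
Qed.

Lemma covers_mul2l g x y : covers (g * x) (g * y) <-> covers x y.
Proof.
split=> -[]; rewrite /covers lt_mul2lE => lt_xy nobetween; split=> // -[z].
  by move=> xzy; apply: nobetween; exists (g * z); rewrite !lt_mul2lE.
rewrite -[z](mulVKg g) !lt_mul2lE => xzy.
by apply: nobetween; exists (g^-1 * z).
Qed.

Lemma atom_quotient g x : covers g x <-> atoms G (g^-1 * x).
Proof. by rewrite -(covers_mul2l g^-1) mulVg. Qed.

Lemma covers_mul_atom g x : atoms G x -> covers g (g * x).
Proof. by move=> atx; apply/atom_quotient; rewrite mulKg. Qed.

Lemma atoms_invP x : atoms G x^-1 <-> covers x 1.
Proof. by rewrite atom_quotient mulg1. Qed.

Lemma coatomsE x : atoms G^d x <-> covers x 1.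
Proof.
split=> -[lt1x none]; split=> //.
  by move=> [z /andP[xz z1]]; apply: none; exists z; apply/andP; split.
by move=> [z /andP[xz z1]]; apply: none; exists z; apply/andP; split.
Qed.

(** By the descending chain condition some element is minimal among those that
are above [1] (excluded) and at most [g]; such an element is an atom. *)
Lemma exists_atom_le g : noetherian G -> 1 < g -> exists2 x, atoms G x & x <= g.
Proof.
move=> [_ dcc] lt1g.
have wf : well_founded (fun x y => 1 < x < y).
  apply: wf_no_descent => u du.
  have [n|n|N /(_ N.+1 (leqnSn N)) eqN] := dcc (fun n => u n.+1).
  - by have /andP[/ltW] := du n.
  - by have /andP[_ /ltW] := du n.+1.
  by have /andP[_] := du N.+1; rewrite eqN ltxx.
elim/(well_founded_induction wf): g lt1g => g IH lt1g.
have [atg|natg] := pselect (atoms G g); first by exists g.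
have [z /andP[lt1z ltzg]] : exists z, 1 < z < g.
  by apply: contrapT => none; apply: natg.
have [||x atx xz] := IH z; rewrite ?lt1z //.
by exists x => //; apply: le_trans xz (ltW ltzg).
Qed.

(** Climb from [1] to [g] by multiplying with atoms on the right.  The climb
ends because [g^-1] translates it into an ascending chain of negative
elements. *)
Lemma pos_ind (P : G -> Prop) : noetherian G -> P 1 ->
  (forall h x, 1 <= h -> atoms G x -> P h -> P (h * x)) ->
  forall g, 1 <= g -> P g.
Proof.
move=> noeG P1 PM g ge1g; have [acc _] := noeG.
have wf : well_founded (fun x y => y < x <= g).
  apply: wf_no_descent => u du.
  have [n|n|N /(_ N.+1 (leqnSn N)) /mulgI eqN] := acc (fun n => g^-1 * u n.+1).
  - by rewrite -(mulVg g) le_mul2lE; case/andP: (du n).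
  - by rewrite le_mul2lE; case/andP: (du n.+1) => /ltW.
  by have /andP[] := du N.+1; rewrite eqN ltxx.
suff climb h : 1 <= h <= g -> P h -> P g by apply: (climb 1); rewrite ?lexx.
elim/(well_founded_induction wf): h => h IH /andP[ge1h hg] Ph.
move: (hg); rewrite le_eqVlt => /predU1P[<- //|lthg].
have [|x atx xle] := @exists_atom_le (h^-1 * g) noeG.
  by rewrite -(mulVg h) lt_mul2lE.
have lthhx : h < h * x by rewrite -[ltLHS]mulg1 lt_mul2lE; case: atx.
have hxg : h * x <= g by rewrite -(mulVKg h g) le_mul2lE.
apply: (IH (h * x)); rewrite ?lthhx //; last exact: PM.
by rewrite hxg (le_trans ge1h (ltW lthhx)).
Qed.

Lemma noetherian_dual : noetherian G -> noetherian G^d.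
Proof. by move=> [acc dcc]; split; [exact: dcc|exact: acc]. Qed.

End LeftOrdered.

(** This is [pos_ind] in the dual, whose atoms are the coatoms. *)
Lemma neg_ind (d : Order.disp_t) (G : leftOrderedGroupType d) (P : G -> Prop) :
  noetherian G -> P 1 ->
  (forall h x, h <= 1 -> covers x 1 -> P h -> P (h * x)) ->
  forall g, g <= 1 -> P g.
Proof.
move=> /noetherian_dual noeG P1 PM; apply: (@pos_ind _ G^d P noeG P1).
by move=> h x h1 /coatomsE; exact: PM.
Qed.

(** * Order isomorphisms *)

Lemma order_iso_comp (d1 d2 d3 : Order.disp_t) (P : porderType d1)
    (Q : porderType d2) (S : porderType d3) (g : Q -> S) (f : P -> Q) :
  order_iso g -> order_iso f -> order_iso (g \o f).
Proof.
move=> [bijg mg] [bijf mf]; split; first exact: bij_comp.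
by move=> x y /=; rewrite mg mf.
Qed.

Lemma order_iso_inv (d1 d2 : Order.disp_t) (P : porderType d1)
    (Q : porderType d2) (f : P -> Q) :
  order_iso f -> exists g, [/\ cancel f g, cancel g f & order_iso g].
Proof.
move=> [[g fK gK] mf]; exists g; split=> //; split; first by exists f.
by move=> x y; rewrite -mf !gK.
Qed.

Lemma order_iso_covers (d1 d2 : Order.disp_t) (G : leftOrderedGroupType d1)
    (H : leftOrderedGroupType d2) (f : G -> H) (x y : G) :
  order_iso f -> covers (f x) (f y) <-> covers x y.
Proof.
move=> [[g fK gK] mf]; have ltf := leW_mono mf.
split=> -[]; rewrite /covers ltf => lt_xy none; split=> // -[z xzy]; apply: none.
  by exists (f z); rewrite !ltf.
by exists (g z); rewrite -!ltf gK.
Qed.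

Lemma order_iso_join (d1 d2 : Order.disp_t) (L : latticeType d1)
    (M : latticeType d2) (f : L -> M) :
  order_iso f -> {morph f : x y / x `|` y}.
Proof.
move=> [[g fK gK] mf] x y; apply/eqP; rewrite eq_le leUx !mf leUl leUr !andbT.
by rewrite -[X in _ <= X]gK mf leUx -!mf gK leUl leUr.
Qed.

Lemma order_iso_noetherian (d1 d2 : Order.disp_t) (G : leftOrderedGroupType d1)
    (H : leftOrderedGroupType d2) (f : H -> G) :
  order_iso f -> f 1 = 1 -> noetherian G -> noetherian H.
Proof.
move=> [/bij_inj injf mf] f1 [acc dcc]; split=> u u1 umon.
- have [n|n|N eqN] := acc (f \o u); rewrite /= -?f1 ?mf //.
  by exists N => n /eqN/injf.
- have [n|n|N eqN] := dcc (f \o u); rewrite /= -?f1 ?mf //.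
  by exists N => n /eqN/injf.
Qed.

Lemma order_iso_dual (d1 d2 : Order.disp_t) (P : porderType d1)
    (Q : porderType d2) (f : P -> Q) :
  order_iso f -> order_iso (f : P^d -> Q^d).
Proof. by move=> [bijf mf]; split=> // x y; apply: mf. Qed.

(** * Rigidity of poset automorphisms *)

Section Rigidity.
Variables (d : Order.disp_t) (G : leftLGroupType d).
Implicit Types (x y z g h : G) (phi : G -> G).

(** The map [phi] seen from [g]: if [phi] fixes [g], then this map fixes [1],
and what is known near [1] can be used near [g]. *)
Definition local_map phi g x : G := g^-1 * phi (g * x).

Lemma local_map_iso phi g : order_iso phi -> order_iso (local_map phi g).
Proof.
move=> iphi.
exact: order_iso_comp (order_iso_mul _) (order_iso_comp iphi (order_iso_mul _)).
Qed.

Lemma local_map_fix phi g x :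
  local_map phi g x = x <-> phi (g * x) = g * x.
Proof.
by rewrite /local_map; split=> [fixx|->]; rewrite ?mulKg // -{2}fixx mulVKg.
Qed.

Lemma local_mapM phi g h :
  local_map phi (g * h) =1 local_map (local_map phi g) h.
Proof. by move=> x; rewrite /local_map invgM !mulgA. Qed.

Lemma below_join_neq x y z : atoms G z -> x * z <= x `|` y -> x <> y.
Proof.
move=> [lt1z _] xzy eq_xy; move: xzy.
by rewrite -eq_xy joinxx -[leRHS]mulg1 le_mul2lE (lt_geF lt1z).
Qed.

Definition fixes_atoms phi := phi 1 = 1 /\ forall x, atoms G x -> phi x = x.

(** The upper covers of [x] are the [x * z] with [z] an atom.  Those below some
join [x `|` y] are fixed since that join determines them; at most one cover
remains, which is then fixed as well. *)
Lemma fixes_atoms_step phi x : rigid G -> order_iso phi -> fixes_atoms phi ->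
  atoms G x -> fixes_atoms (local_map phi x).
Proof.
move=> [_ uniq_below uniq_free] iphi [phi1 phiA] atx.
have mphi : {mono phi : x y / x <= y} by case: iphi.
have phi_join y : atoms G y -> phi (x `|` y) = x `|` y.
  by move=> aty; rewrite order_iso_join // !phiA.
split=> [|z atz]; first by apply/local_map_fix; rewrite mulg1 phiA.
set z' := local_map phi x z.
have xz' : x * z' = phi (x * z) by rewrite mulVKg.
have atz' : atoms G z'.
  apply/(atom_quotient x); rewrite -{1}(phiA x atx).
  by apply/order_iso_covers => //; apply: covers_mul_atom.
have below y : atoms G y -> (x * z' <= x `|` y) = (x * z <= x `|` y).
  by move=> aty; rewrite xz' -{1}phi_join // mphi.
have [[y aty xzy]|none] := pselect (exists2 y, atoms G y & x * z <= x `|` y).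
  have neq_xy := below_join_neq atz xzy.
  have [w [_ uniqw]] := uniq_below x y atx aty neq_xy.
  by rewrite -(uniqw z) // -(uniqw z') // below.
apply: (uniq_free x) => // y aty; rewrite ?below // => xzy; apply: none.
  by exists y.
by exists y.
Qed.

Lemma fixes_atoms_pos phi : rigid G -> order_iso phi -> fixes_atoms phi ->
  forall g, 1 <= g -> phi g = g.
Proof.
move=> rigG iphi fixphi g ge1g; have [noeG _ _] := rigG.
suff [/local_map_fix] : fixes_atoms (local_map phi g) by rewrite mulg1.
move: g ge1g; apply: pos_ind => // [|h x _ atx IH].
  by case: fixphi => phi1 phiA; split=> [|x atx]; apply/local_map_fix;
    rewrite mul1g //; exact: phiA.
have [fix1 fixA] := fixes_atoms_step rigG (local_map_iso h iphi) IH atx.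
by split=> [|y aty]; rewrite local_mapM ?fix1 ?fixA.
Qed.

(** Sending [y] to the atom [z] with [x * z <= x `|` y] maps the atoms other
than [x] to the atoms, and it factors through [y |-> x `|` y].  The second
rigidity condition says that it misses at most one atom.  If there are [n]
atoms, its [n - 1] arguments thus have at least [n - 1] values, so that it is
injective. *)
Lemma join_determines_atom x y y' : rigid G -> finite_set (atoms G) ->
  atoms G x -> atoms G y -> atoms G y' -> x <> y -> x <> y' ->
  x `|` y = x `|` y' -> y = y'.
Proof.
move=> [_ uniq_below uniq_free] /finite_seqP[s0 atE] atx aty aty' nxy nxy' eqj.
pose s := undup s0.
have atP z : atoms G z <-> z \in s by rewrite mem_undup atE.
have /choice[f fP] : forall y, exists z, atoms G y -> x <> y ->
    atoms G z /\ x * z <= x `|` y.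
  move=> u; have [[atu nxu]|nope] := pselect (atoms G u /\ x <> u).
    by have [z [zP _]] := uniq_below x u atx atu nxu; exists z.
  by exists 1 => atu nxu; case: nope.
(* The arguments of the map: the atoms other than [x]. *)
pose s' := rem x s.
have s'P u : u \in s' <-> atoms G u /\ x <> u.
  rewrite (mem_rem_uniq _ (undup_uniq s0)) inE.
  by split=> [/andP[/eqP nux /atP]|[/atP-> nxu]];
     [split=> // ux; apply: nux|rewrite andbT; apply/eqP => ux; apply: nxu].
have hit z u : atoms G z -> atoms G u -> x * z <= x `|` u -> z \in map f s'.
  move=> atz atu xzu.
  have nxu := below_join_neq atz xzu.
  have [w [_ uniqw]] := uniq_below x u atx atu nxu.
  apply/mapP; exists u; first exact/s'P.
  by rewrite -(uniqw z) // -(uniqw (f u)) //; apply: fP.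
(* The atom missed by the map, or [x] as a dummy if none is missed. *)
have [t coverst] : exists t, {subset s <= t :: map f s'}.
  have [[t [att freet]]|allhit] := pselect (exists t, atoms G t /\
      forall u, atoms G u -> ~ (x * t <= x `|` u)).
    exists t => z /atP atz; rewrite inE; apply/orP.
    have [[u atu xzu]|none] := pselect (exists2 u, atoms G u & x * z <= x `|` u).
      by right; apply: hit xzu.
    left; apply/eqP/(uniq_free x) => // u atu xzu; apply: none.
    by exists u.
  exists x => z /atP atz; rewrite inE; apply/orP; right.
  apply: contrapT => nhit; apply: allhit; exists z; split=> // u atu xzu.
  by apply: nhit; apply: hit xzu.
have xs : x \in s by apply/atP.
have sz : (size (t :: map f s') <= size s)%N.
  by rewrite /= size_map size_rem // prednK //; case: (s) xs.
have /andP[_ uniqf] := leq_size_uniq (undup_uniq s0) coverst sz.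
have fyy' : f y = f y'.
  have [w [_ uniqw]] := uniq_below x y atx aty nxy.
  rewrite -(uniqw (f y)); last exact: fP.
  by rewrite -(uniqw (f y')) // eqj; apply: fP.
have iy : y \in s' by apply/s'P.
have iy' : y' \in s' by apply/s'P.
have := uniqf => /(uniqP 1); rewrite size_map => /(_ (index y s') (index y' s')).
rewrite !inE !index_mem iy iy' => /(_ isT isT).
rewrite !(nth_map 1) ?index_mem // !nth_index // => /(_ fyy') eqi.
by rewrite -(nth_index 1 iy) eqi nth_index.
Qed.

(** For an atom [y] other than [x], the atom [phi y] has the same join with [x]
as [y], because this join lies above [x] and so is fixed. *)
Lemma fixes_atoms_below phi x : rigid G -> finite_set (atoms G) ->
  order_iso phi -> phi 1 = 1 -> atoms G x ->
  (forall g, x <= g -> phi g = g) -> fixes_atoms phi.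
Proof.
move=> rigG finG iphi phi1 atx fixx; split=> // y aty.
have [<-|nxy] := pselect (x = y); first exact: fixx.
have phix : phi x = x by exact: fixx.
apply/esym/(@join_determines_atom x) => //.
- by rewrite /atoms /= -phi1 order_iso_covers.
- by rewrite -{1}phix => /(bij_inj (proj1 iphi)).
by rewrite -{2}phix -order_iso_join // fixx // leUl.
Qed.

End Rigidity.

(** The induction descends from [1] through coatoms; the claim carried along is
that everything above the current element is fixed. *)
Lemma poset_automorphism_rigidity (d : Order.disp_t) (G : leftLGroupType d)
    (phi : G -> G) :
  bi_rigid G -> finite_set (atoms G) -> order_iso phi -> phi 1 = 1 ->
  (forall x, atoms G x -> phi x = x) ->
  (forall x, covers x 1 -> phi x = x) -> phi =1 id.
Proof.
move=> [rigG rigGd] finG iphi phi1 fixA fixC g.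
have fix_neg h : h <= 1 -> phi h = h.
  apply: (@fixes_atoms_pos _ G^d phi rigGd (order_iso_dual iphi)).
  by split=> // x /coatomsE/fixC.
suff fix_up h : h <= 1 -> forall k, h <= k -> phi k = k.
  by apply: (fix_up (g `&` 1)); rewrite ?leIl ?leIr.
have [noeG _ _] := rigG.
move: h; apply: neg_ind => // [|h c le1h covc fix_up].
  exact: fixes_atoms_pos.
have atx : atoms G c^-1 by apply/atoms_invP.
have lehc1 : h * c <= 1.
  by apply: le_trans le1h; rewrite -[leRHS]mulg1 le_mul2lE; case: covc => /ltW.
have fixloc : fixes_atoms (local_map phi (h * c)).
  apply: (fixes_atoms_below rigG finG (local_map_iso _ iphi) _ atx).
    by apply/local_map_fix; rewrite mulg1 fix_neg.
  move=> k; rewrite -(le_mul2lE (h * c)) mulgK => lehk.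
  by apply/local_map_fix/fix_up.
move=> k; rewrite -{1}[h * c]mulg1 -{1}(mulVKg (h * c) k) le_mul2lE => ge1.
have /local_map_fix := fixes_atoms_pos rigG (local_map_iso (h * c) iphi) fixloc ge1.
by rewrite mulVKg.
Qed.

(** * Transported group laws *)

(** An element [h] is [a * (a^-1 * h)], where [a] is a common upper bound of [h]
and [1]: a positive factor times a negative one. *)
Lemma generators_ind (d : Order.disp_t) (H : leftOrderedGroupType d)
    (P : H -> Prop) :
  noetherian H -> (forall h : H, exists2 a, 1 <= a & h <= a) -> P 1 ->
  (forall h x, atoms H x \/ covers x 1 -> P h -> P (h * x)) ->
  forall h, P h.
Proof.
move=> noeH dirH P1 PM h; have [a ge1a leha] := dirH h.
have Pa : P a.
  by move: a ge1a {leha}; apply: pos_ind => // k x _ atx; apply: PM; left.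
rewrite -(mulVKg a h); have : a^-1 * h <= 1 by rewrite -(mulVg a) le_mul2lE.
move: (a^-1 * h); apply: neg_ind => // [|k x _ cx]; first by rewrite mulg1.
by rewrite mulgA; apply: PM; right.
Qed.

Section Formations.
Variables (d : Order.disp_t) (G : leftLGroupType d).
Implicit Types (F : formation G) (g h k x y : G).

Definition form_inv F : G -> form_group F :=
  projT1 (cid (order_iso_inv (form_iso F))).

Lemma form_mapK F : cancel (form_map F) (form_inv F).
Proof. by rewrite /form_inv; case: cid => f []. Qed.

Lemma form_invK F : cancel (form_inv F) (form_map F).
Proof. by rewrite /form_inv; case: cid => f []. Qed.

Lemma form_inv_iso F : order_iso (form_inv F).
Proof. by rewrite /form_inv; case: cid => f []. Qed.

Lemma form_inv1 F : form_inv F 1 = 1.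
Proof. by rewrite -(form_map1 F) form_mapK. Qed.

Definition form_law F g h : G := form_map F (form_inv F g * form_inv F h).

Lemma form_map_law F (u v : form_group F) :
  form_map F (u * v) = form_law F (form_map F u) (form_map F v).
Proof. by rewrite /form_law !form_mapK. Qed.

Lemma form_lawg1 F g : form_law F g 1 = g.
Proof. by rewrite /form_law form_inv1 mulg1 form_invK. Qed.

Lemma form_law1g F g : form_law F 1 g = g.
Proof. by rewrite /form_law form_inv1 mul1g form_invK. Qed.

Lemma form_lawA F g h k :
  form_law F (form_law F g h) k = form_law F g (form_law F h k).
Proof. by rewrite /form_law !form_mapK mulgA. Qed.

Lemma form_law_iso F g : order_iso (form_law F g).
Proof.
have imul := order_iso_mul (form_inv F g).
exact: order_iso_comp (form_iso F) (order_iso_comp imul (form_inv_iso F)).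
Qed.

Lemma equiv_of_form_law F F' :
  form_law F =2 form_law F' -> formation_equiv F F'.
Proof.
move=> eqlaw; exists (form_inv F' \o form_map F); split.
- exact: order_iso_comp (form_inv_iso F') (form_iso F).
- move=> u v; apply: (can_inj (@form_mapK F')).
  by rewrite form_map_law /= !form_invK form_map_law eqlaw.
by move=> u /=; rewrite form_invK.
Qed.

Definition unit_neighbour x := atoms G x \/ covers x 1.

Lemma iso_unit_neighbour (phi : G -> G) x : order_iso phi -> phi 1 = 1 ->
  unit_neighbour x -> unit_neighbour (phi x).
Proof.
by move=> iphi phi1 [cov|cov]; [left|right]; rewrite /atoms /= -phi1;
   apply/order_iso_covers.
Qed.

(** Associativity propagates the agreement of two translations from the
generators to all products of generators. *)
Lemma form_law_generated F F' : noetherian G ->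
  (forall x, unit_neighbour x -> form_law F x =1 form_law F' x) ->
  form_law F =2 form_law F'.
Proof.
move=> noeG eqlaw.
suff eqmap u : form_law F (form_map F u) =1 form_law F' (form_map F u).
  by move=> g; rewrite -(form_invK F g); exact: eqmap.
move: u; apply: generators_ind.
- exact: order_iso_noetherian (form_iso F) (form_map1 F) noeG.
- move=> u; exists (form_inv F (form_map F u `|` 1)).
    by rewrite -(form_inv1 F) (proj2 (form_inv_iso F)) leUr.
  by rewrite -{1}(form_mapK u) (proj2 (form_inv_iso F)) leUl.
- by move=> g; rewrite form_map1 !form_law1g.
move=> u v nbv IH g.
have nbx : unit_neighbour (form_map F v).
  case: nbv => cov; [left|right];
    by rewrite /atoms /= -(form_map1 F); apply/order_iso_covers => //;
       apply: form_iso.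
by rewrite form_map_law form_lawA IH (eqlaw _ nbx) -form_lawA -IH.
Qed.

(** Both translations send [1] to [x], so one followed by the inverse of the
other fixes [1], and rigidity applies to it. *)
Lemma form_law_locally_determined F F' x : bi_rigid G -> finite_set (atoms G) ->
  (forall y, unit_neighbour y -> form_law F x y = form_law F' x y) ->
  form_law F x =1 form_law F' x.
Proof.
move=> birG finG eqlaw g.
have [psi [lawK psiK ipsi]] := order_iso_inv (form_law_iso F' x).
rewrite -[LHS]psiK; congr (form_law F' x _); move: g.
apply: (@poset_automorphism_rigidity _ G (psi \o form_law F x)) => //=.
- exact: order_iso_comp ipsi (form_law_iso F x).
- by rewrite form_lawg1 -[X in psi X](form_lawg1 F') lawK.
- by move=> y aty; rewrite eqlaw ?lawK //; left.
- by move=> y cy; rewrite eqlaw ?lawK //; right.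
Qed.

(** This is what makes the invariant of a formation take finitely many values:
the atoms and coatoms are permuted by any automorphism fixing [1]. *)
Lemma form_law_neighbour F x y :
  unit_neighbour y -> unit_neighbour (x^-1 * form_law F x y).
Proof.
apply: (iso_unit_neighbour (phi := fun y => x^-1 * form_law F x y)).
  exact: order_iso_comp (order_iso_mul _) (form_law_iso F x).
by rewrite form_lawg1 mulVg.
Qed.

(** The coatoms are the inverses of the atoms. *)
Lemma finite_unit_neighbours : finite_set (atoms G) ->
  exists s : seq G, forall x, unit_neighbour x -> x \in s.
Proof.
move=> /finite_seqP[s atE]; exists (s ++ map (fun x => x^-1) s) => x.
have atP y : atoms G y -> y \in s by rewrite atE.
rewrite mem_cat => -[/atP-> //|/atoms_invP/atP xs]; apply/orP; right.
by apply/mapP; exists x^-1; rewrite ?invgK.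
Qed.

End Formations.

Theorem theorem2p10 (d : Order.disp_t) (G : leftLGroupType d) :
  bi_rigid G -> finite_set (atoms G) ->
  exists (n : nat) (F : 'I_n -> formation G),
    forall F' : formation G, exists i : 'I_n, formation_equiv F' (F i).
Proof.
move=> birG finG; have noeG : noetherian G by case: birG => -[].
have [s sP] := finite_unit_neighbours finG.
pose code (F : formation G) :
    {ffun seq_sub s * seq_sub s -> option (seq_sub s)} :=
  [ffun p => insub ((val p.1)^-1 * form_law F (val p.1) (val p.2))].
have code_inj F F' : code F = code F' -> formation_equiv F F'.
  move=> eqcode; apply/equiv_of_form_law/form_law_generated => // x nbx.
  apply: form_law_locally_determined => // y nby.
  have inF := sP _ (form_law_neighbour F x nby).
  have inF' := sP _ (form_law_neighbour F' x nby).
  have /ffunP /(_ (SeqSub (sP x nbx), SeqSub (sP y nby))) := eqcode.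
  by rewrite !ffunE /= (insubT (mem s) inF) (insubT (mem s) inF') => -[] /mulgI.
have idP : order_iso (@id G) by split=> //; exists id.
pose F0 : formation G := @Formation d G d G id idP erefl.
(* A value that is not attained by [code] is represented by the trivial
   formation. *)
have /choice[rep repP] :
    forall c, exists F, forall F', code F' = c -> code F = c.
  move=> c; have [[F Fc]|none] := pselect (exists F, code F = c).
    by exists F.
  by exists F0 => F' F'c; case: none; exists F'.
exists #|{ffun seq_sub s * seq_sub s -> option (seq_sub s)}|.
exists (fun i => rep (enum_val i)) => F'; exists (enum_rank (code F')).
by apply: code_inj; rewrite enum_rankK (repP _ F').
Qed.
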